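(* For every finite connected transitive graph $\mathbb G$ with $V$ vertices of degree $\Omega$, the following statements hold. (i) If $\lambda>0$ and the triangle condition $\nabla_{p_c}(x,y)\le \delta_{x,y}+a_0$ (for all $x,y\in\mathbb V$) holds at $p_c=p_c(\mathbb G,\lambda)$ for some constant $a_0<1$, then, with $\epsilon_0=1/\chi(p_c)=\lambda^{-1}V^{-1/3}$, $$1-\epsilon_0\le \Omega p_c\le \frac{1-\epsilon_0}{1-a_0}.$$ (ii) Given $0<\lambda_1<\lambda_2<\infty$, let $p_i$ be defined by $\chi(p_i)=\lambda_i V^{1/3}$ ($i=1,2$). If $\bar\nabla_{p_2}<1$, where $\bar\nabla_p=\max_{\{x,y\}\in\mathbb B}\nabla_p(x,y)$, then $$\frac{\lambda_2-\lambda_1}{\lambda_1\lambda_2}\frac1{V^{1/3}}\le \Omega(p_2-p_1)\le \frac{1}{1-\bar\nabla_{p_2}}\,\frac{\lambda_2-\lambda_1}{\lambda_1\lambda_2}\frac1{V^{1/3}}.$$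
   Context: $\mathbb G=(\mathbb V,\mathbb B)$ is a finite connected graph with vertex set $\mathbb V$ and bond (edge) set $\mathbb B$, a set of two-element subsets of $\mathbb V$. It is transitive: for all $x,y\in\mathbb V$ there is a bijection $\varphi:\mathbb V\to\mathbb V$ with $\{\varphi(u),\varphi(v)\}\in\mathbb B$ whenever $\{u,v\}\in\mathbb B$, such that $\varphi(x)=y$. $V=|\mathbb V|$, and $\Omega$ is the common degree of the vertices. In percolation with parameter $p\in[0,1]$ each bond is independently occupied with probability $p$ and vacant otherwise; $\mathbb P_p,\mathbb E_p$ denote probability and expectation. $x\leftrightarrow y$ means there is a path of occupied bonds from $x$ to $y$ (and $x\leftrightarrow x$ always); $\tau_p(x,y)=\mathbb P_p(x\leftrightarrow y)$; $C(x)$ is the set of vertices connected to $x$; $0\in\mathbb V$ is a fixed vertex; $\chi(p)=\mathbb E_p|C(0)|$, a strictly increasing function of $p\in[0,1]$ with $\chi(0)=1$, $\chi(1)=V$. The triangle diagram is $\nabla_p(x,y)=\sum_{u,v\in\mathbb V}\tau_p(x,u)\tau_p(u,v)\tau_p(v,y)$. For $\lambda>0$, the critical threshold $p_c=p_c(\mathbb G,\lambda)$ is the unique solution of $\chi(p_c)=\lambda V^{1/3}$; it is always assumed that $1<\lambda V^{1/3}<V$ (and likewise for $\lambda_1,\lambda_2$), so that the threshold is well defined and lies in $(0,1)$. *)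

(* Defs.v *)
From HB Require Import structures.
From mathcomp Require Import all_boot all_order all_algebra.
From mathcomp Require Import reals exp.

Set Implicit Arguments.
Unset Strict Implicit.
Unset Printing Implicit Defensive.

Import Order.TTheory GRing.Theory Num.Theory.
Local Open Scope ring_scope.

(* A graph is given by its finite vertex type T and its set B of bonds; sets
   of bonds (all of B, or the occupied ones) have type {set {set T}}. *)

Definition is_bond_set (T : finType) (B : {set {set T}}) : Prop :=
  forall b, b \in B -> #|b| = 2%N.

Definition adj (T : finType) (w : {set {set T}}) : rel T :=
  fun x y => [set x; y] \in w.

Definition is_connected (T : finType) (B : {set {set T}}) : Prop :=
  forall x y, connect (adj B) x y.

Definition is_transitive (T : finType) (B : {set {set T}}) : Prop :=
  forall x y : T, exists phi : T -> T,
    [/\ bijective phi,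
        forall u v, [set u; v] \in B -> [set phi u; phi v] \in B
      & phi x = y].

Definition degree (T : finType) (B : {set {set T}}) (x : T) : nat :=
  #|[set b in B | x \in b]|.

(* Bond percolation: a configuration is the set w \subset B of occupied bonds,
   and the law of w is the product over B of Bernoulli(p) laws. *)
Definition weight (T : finType) (R : realType) (B : {set {set T}}) (p : R)
    (w : {set {set T}}) : R :=
  \prod_(b in B) (if b \in w then p else 1 - p).

Definition expect (T : finType) (R : realType) (B : {set {set T}}) (p : R)
    (f : {set {set T}} -> R) : R :=
  \sum_(w in powerset B) weight B p w * f w.

Definition prob (T : finType) (R : realType) (B : {set {set T}}) (p : R)
    (E : pred {set {set T}}) : R :=
  \sum_(w in powerset B | E w) weight B p w.

Definition cluster (T : finType) (w : {set {set T}}) (x : T) : {set T} :=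
  [set y | connect (adj w) x y].

Definition tau (T : finType) (R : realType) (B : {set {set T}}) (p : R)
    (x y : T) : R :=
  prob B p (fun w => connect (adj w) x y).

Definition chi (T : finType) (R : realType) (B : {set {set T}}) (o : T)
    (p : R) : R :=
  expect B p (fun w => #|cluster w o|%:R).

Definition nabla (T : finType) (R : realType) (B : {set {set T}}) (p : R)
    (x y : T) : R :=
  \sum_(u : T) \sum_(v : T) tau B p x u * tau B p u v * tau B p v y.

(* The default value 0 of the maximum is harmless: nabla is nonnegative for p
   in [0, 1], and a connected graph with at least two vertices has a bond. *)
Definition nabla_bar (T : finType) (R : realType) (B : {set {set T}})
    (p : R) : R :=
  \big[Num.max/0]_(xy : T * T | [set xy.1; xy.2] \in B) nabla B p xy.1 xy.2.

Definition cbrtV (T : finType) (R : realType) : R := #|T|%:R `^ 3^-1.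

(* For 1 < lam * V^(1/3) < V there is exactly one such p, as chi is continuous
   and strictly increasing on [0, 1], from 1 to V. *)
Definition is_threshold (T : finType) (R : realType) (B : {set {set T}})
    (o : T) (lam p : R) : Prop :=
  0 <= p <= 1 /\ chi B o p = lam * cbrtV T R.

Definition triangle_condition (T : finType) (R : realType)
    (B : {set {set T}}) (p a0 : R) : Prop :=
  forall x y : T, nabla B p x y <= (x == y)%:R + a0.

(* Main.v *)
Require Import Defs.
From HB Require Import structures.
From mathcomp Require Import all_boot all_order all_algebra.
From mathcomp Require Import reals exp derive realfun.
From mathcomp Require Import ring lra.

Set Implicit Arguments.
Unset Strict Implicit.
Unset Printing Implicit Defensive.

Import Order.TTheory GRing.Theory Num.Theory.
Import normed_module.numFieldNormedType.Exports.
Local Open Scope ring_scope.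

(** Both parts follow from the differential inequalities
<<
      (1 - c) Omega chi(p)^2 <= chi'(p) <= Omega chi(p)^2
>>
    where c bounds the triangle diagram on the bonds at p, or at any larger
    parameter since the diagram increases with p. Dividing by chi^2, they say
    that -(1/chi)' lies between (1 - c) Omega and Omega; integrating from 0, where
    chi = 1, to pc gives the first part, and integrating from p1 to p2 the second
    one (lemma [chi_inv_increment]).

    By transitivity chi is the mean over x of the expected size of the cluster of
    x. Russo's formula ([is_derive_expect]) then writes #|T| chi' as a sum over the
    bonds uv of the mean increase of the number of connected ordered pairs when uv
    is opened, which is twice the expectation of |C(u)| |C(v)| on the event that v
    is not in C(u), where the clusters are taken off the bond uv
    ([sum_card_cluster_setU1], [pivotal_pairs]). Since twice the number of bonds
    is Omega #|T|, it suffices to bound this expectation by chi^2 from above and by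
    (1 - c) chi^2 from below.

    Explore C(u) first. Given C(u) = A with v outside A, the cluster of v is an
    independent percolation cluster in the complement of A
    ([pivotal_pairs_explore]), of mean size at most chi: this is the upper bound
    ([pivotal_pairs_le]). For the lower bound ([pivotal_pairs_ge]), avoiding A
    costs at most chi times the sum of tau(v, a) over a in A, by the
    van den Berg-Kesten inequality ([berg_kesten], [chi_avoiding]); the mean of
    |C(u)| times this sum is at most chi^2 times the triangle diagram, by the
    tree-graph inequality ([tree_graph]). Deleting the bond uv from the cluster
    of u costs nothing, by a pointwise comparison special to the function of the
    cluster that occurs here. *)

(** * Expectations under bond percolation *)

Lemma weight_setD1 (T : finType) (R : realType) (B w : {set {set T}})
    (p : R) (e : {set T}) :
  e \in B ->
  weight B p w = (if e \in w then p else 1 - p) * weight (B :\ e) p w.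
Proof.
move=> eB; rewrite /weight (big_setD1 e eB) /=; congr (_ * _).
Qed.

Lemma eq_weight (T : finType) (R : realType) (B w w' : {set {set T}}) (p : R) :
  {in B, forall b, (b \in w) = (b \in w')} -> weight B p w = weight B p w'.
Proof. by move=> eqw; apply: eq_bigr => b bB; rewrite eqw. Qed.

Lemma eq_expect (T : finType) (R : realType) (B : {set {set T}}) (p : R)
    (f g : {set {set T}} -> R) :
  (forall w : {set {set T}}, w \subset B -> f w = g w) -> expect B p f = expect B p g.
Proof.
by move=> fg; apply: eq_bigr => w; rewrite powersetE => wB; rewrite fg.
Qed.

(** Conditioning on the state of one bond. Independence, the derivative in p and
    the van den Berg-Kesten inequality all follow from this by treating the bonds
    one at a time. *)
Lemma expect_split (T : finType) (R : realType) (B : {set {set T}}) (p : R)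
    (e : {set T}) (f : {set {set T}} -> R) :
  e \in B ->
  expect B p f =
    expect (B :\ e) p (fun w => p * f (e |: w) + (1 - p) * f w).
Proof.
move=> eB; rewrite /expect (bigID (fun w : {set {set T}} => e \in w)) /=.
under [RHS]eq_bigr do rewrite mulrDr.
rewrite big_split /=; congr (_ + _).
  rewrite (reindex_onto (fun w : {set {set T}} => e |: w) (fun w => w :\ e)) /=; last first.
    by move=> w /andP[_ ew]; rewrite setD1K.
  apply: eq_big => [w|w].
    rewrite !powersetE setU11 andbT subUset sub1set eB /=.
    rewrite subsetD1; case: eqP => [ww|ww].
      by have := congr1 (fun A : {set _} => e \in A) ww; rewrite !inE eqxx => /= <-.
    rewrite andbF; apply/esym/negP => /andP[_ ew].
    by apply: ww; rewrite setU1K.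
  move=> _; rewrite (weight_setD1 _ _ eB) setU11 mulrA [_ * p]mulrC.
  congr (_ * _ * _); apply: eq_weight => b; rewrite !inE => /andP[/negbTE -> _].
  by [].
apply: eq_big => [w|w /andP[_ /negbTE ew]].
  by rewrite !powersetE subsetD1.
by rewrite (weight_setD1 _ _ eB) ew mulrA [_ * (1 - p)]mulrC.
Qed.

Lemma setD1_ind (E : finType) (P : {set E} -> Prop) :
  P set0 -> (forall (B : {set E}) e, e \in B -> P (B :\ e) -> P B) -> forall B, P B.
Proof.
move=> P0 PD B; have [n] := ubnP #|B|; elim: n B => // n IH B leBn.
have [->//|[e eB]] := set_0Vmem B; apply: (PD _ e eB); apply: IH.
by rewrite (cardsD1 e) eB in leBn.
Qed.

Section Expectation.

Variables (T : finType) (R : realType) (p : R).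
Implicit Types (B w : {set {set T}}) (f g : {set {set T}} -> R).

Lemma expect0 f : expect set0 p f = f set0.
Proof. by rewrite /expect powerset0 big_set1 /weight big_set0 mul1r. Qed.

Lemma expectD B f g :
  expect B p (fun w => f w + g w) = expect B p f + expect B p g.
Proof. by rewrite -big_split; apply: eq_bigr => w _; rewrite mulrDr. Qed.

Lemma expectZ B c f : expect B p (fun w => c * f w) = c * expect B p f.
Proof. by rewrite mulr_sumr; apply: eq_bigr => w _; rewrite mulrCA. Qed.

Lemma expectZr B c f : expect B p (fun w => f w * c) = expect B p f * c.
Proof. by rewrite mulr_suml; apply: eq_bigr => w _; rewrite mulrA. Qed.

Lemma expectB B f g :
  expect B p (fun w => f w - g w) = expect B p f - expect B p g.
Proof. by rewrite -sumrB; apply: eq_bigr => w _; rewrite mulrBr. Qed.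

Lemma expect_sum B (I : Type) (r : seq I) (P : pred I)
    (F : I -> {set {set T}} -> R) :
  expect B p (fun w => \sum_(i <- r | P i) F i w)
    = \sum_(i <- r | P i) expect B p (F i).
Proof.
by rewrite exchange_big; apply: eq_bigr => w _; rewrite mulr_sumr.
Qed.

Lemma expect_cst B c : expect B p (fun=> c) = c.
Proof.
elim/setD1_ind: B c => [c|B e eB IH c]; first by rewrite expect0.
rewrite (expect_split _ _ eB) IH; ring.
Qed.

Lemma prob_expect B (E : pred {set {set T}}) :
  prob B p E = expect B p (fun w => (E w)%:R).
Proof.
rewrite /prob /expect big_mkcondr; apply: eq_bigr => w _.
by case: ifP; rewrite (mulr1, mulr0).
Qed.

(** The first factor reads only the bonds in S, the second only those outside S,
    so conditioning on one bond affects a single factor and the product form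
    is preserved. *)
Lemma expect_indep B (S : {set {set T}}) f g :
  expect B p (fun w => f (w :&: S) * g (w :\: S))
    = expect B p (fun w => f (w :&: S)) * expect B p (fun w => g (w :\: S)).
Proof.
elim/setD1_ind: B f g => [f g|B e eB IH f g]; first by rewrite !expect0.
rewrite 3!(expect_split _ _ eB).
have [eS|eS] := boolP (e \in S).
  have UI w : (e |: w) :&: S = e |: w :&: S.
    by rewrite setIUl (setIidPl _) ?sub1set.
  have UD w : (e |: w) :\: S = w :\: S.
    by rewrite setDUl (_ : [set e] :\: S = set0) ?set0U //; apply/eqP;
      rewrite setD_eq0 sub1set.
  have := IH (fun X => p * f (e |: X) + (1 - p) * f X) g.
  under eq_expect do rewrite -UI; move=> IH1.
  under [in RHS]eq_expect do rewrite UI.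
  under [X in _ = _ * X]eq_expect do rewrite UD -mulrDl subrKC mul1r.
  rewrite -IH1; apply: eq_expect => w _ /=; rewrite UI UD; ring.
have UI w : (e |: w) :&: S = w :&: S.
  apply/setP => x; rewrite !inE; case: eqP => [->|//].
  by rewrite (negbTE eS) !andbF.
have UD w : (e |: w) :\: S = e |: w :\: S.
  rewrite setDUl; congr (_ :|: _); apply/setP => x; rewrite !inE.
  by case: eqP => [->|]; rewrite ?eS ?andbF.
have := IH f (fun X => p * g (e |: X) + (1 - p) * g X) => IH1.
rewrite (_ : expect _ _ (fun w => _ * f _ + _) =
   expect (B :\ e) p (fun w => f (w :&: S))); last first.
  by apply: eq_expect => w _; rewrite UI; ring.
rewrite (_ : expect _ _ (fun w => _ * g _ + _) =
   expect (B :\ e) p (fun w => p * g (e |: w :\: S) + (1 - p) * g (w :\: S)));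
  last by apply: eq_expect => w _; rewrite UD.
by rewrite -IH1; apply: eq_expect => w _; rewrite UI UD; ring.
Qed.

End Expectation.

(** * Dependence on the parameter *)

Section Monotone.

Variables (T : finType) (R : realType) (p : R).
Hypothesis p01 : 0 <= p <= 1.
Implicit Types (B w : {set {set T}}) (f g : {set {set T}} -> R).

Lemma le_expect B f g :
  (forall w, w \subset B -> f w <= g w) -> expect B p f <= expect B p g.
Proof.
move=> fg; apply: ler_sum => w; rewrite powersetE => /fg; apply: ler_wpM2l.
by apply: prodr_ge0 => b _; case: ifP => _; move: p01; lra.
Qed.

Lemma expect_ge0 B f :
  (forall w, w \subset B -> 0 <= f w) -> 0 <= expect B p f.
Proof. by move=> f0; rewrite -[leLHS](expect_cst p B); apply: le_expect. Qed.

Lemma prob_ge0 B (E : pred {set {set T}}) : 0 <= prob B p E.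
Proof. by rewrite prob_expect; apply: expect_ge0 => w _; rewrite ler0n. Qed.

End Monotone.

(** Russo's formula: the expectation is affine in the parameter of each bond
    separately, with slope the mean effect of opening that bond; letting all the
    parameters move together adds up the slopes. *)
Lemma is_derive_expect (T : finType) (R : realType) (B : {set {set T}}) 
    (f : {set {set T}} -> R) (p : R) :
  is_derive p (1 : R) (fun q : R => expect B q f)
    (\sum_(e in B) expect B p (fun w => f (e |: w) - f (w :\ e))).
Proof.
elim/setD1_ind: B f => [f|B e eB IH f].
  rewrite big_set0; under boolp.eq_fun do rewrite expect0.
  exact: is_derive_cst.
under boolp.eq_fun do rewrite (expect_split _ _ eB) expectD 2!expectZ.
have d1 := IH (fun w => f (e |: w)); have d0 := IH f.
apply: is_derive_eq.
rewrite (big_setD1 e eB) /=.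
rewrite (expect_split _ _ eB).
rewrite [X in _ = X + _](_ : _ =
  expect (B :\ e) p (fun w => f (e |: w)) - expect (B :\ e) p f); last first.
  rewrite -expectB; apply: eq_expect => w; rewrite subsetD1 => /andP[_ ew].
  rewrite setUA setUid setU1K // (setDidPl _) ?disjoints1 //.
    by ring.
  by rewrite disjoint_sym disjoints1.
rewrite [X in _ = _ + X](_ : _ = \sum_(b in B :\ e)
    (p * expect (B :\ e) p (fun w => f (e |: (b |: w)) - f (e |: w :\ b)) +
      (1 - p) * expect (B :\ e) p (fun w => f (b |: w) - f (w :\ b)))); last first.
  apply: eq_bigr => b; rewrite !inE => /andP[be bB].
  rewrite (expect_split _ _ eB) -!expectZ -expectD; apply: eq_expect => w _.
  rewrite setUCA; congr (_ * (_ - f _) + _).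
  apply/setP => x; rewrite !inE; case: (x =P b) => [->|//].
  by rewrite (negbTE be).
rewrite big_split /= -!mulr_sumr /GRing.scale /=.
ring.
Qed.

Lemma le_expect_param (T : finType) (R : realType) (B : {set {set T}})
    (f : {set {set T}} -> R) (p q : R) :
  (forall w w' : {set {set T}}, w \subset w' -> f w <= f w') ->
  0 <= p -> p <= q -> q <= 1 -> expect B p f <= expect B q f.
Proof.
move=> fincr p0 pq q1.
have dE x := is_derive_expect B f x.
apply: (@ger0_derive1_ndecr R (fun x => expect B x f) 0 1) => //.
- move=> x; rewrite in_itv /= => /andP[x0 x1].
  rewrite derive1E derive_val sumr_ge0 // => e eB.
  apply: expect_ge0; first by rewrite !ltW.
  move=> w _; rewrite subr_ge0 fincr // (subset_trans (subD1set _ _)) //.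
  exact: subsetUr.
- apply: derivable_within_continuous => x _; exact: ex_derive.
Qed.

(** * The van den Berg-Kesten inequality *)

Definition increasing_event (E : finType) (A : pred {set E}) : Prop :=
  forall w w' : {set E}, w \subset w' -> A w -> A w'.

Definition disjoint_occurrence (E : finType) (A1 A2 : pred {set E}) :
    pred {set E} := fun w =>
  [exists S : {set E} * {set E},
     [&& S.1 \subset w, S.2 \subset w, A1 S.1, A2 S.2 & [disjoint S.1 & S.2]]].

Lemma disjoint_occurrence_increasing (E : finType) (A1 A2 : pred {set E}) :
  increasing_event (disjoint_occurrence A1 A2).
Proof.
move=> w w' ww' /existsP[S /and5P[S1 S2 AS1 AS2 dS]]; apply/existsP; exists S.
by rewrite (subset_trans S1 ww') (subset_trans S2 ww') AS1 AS2.
Qed.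

(** Interpolates between disjoint occurrence in one configuration (w1 = w2 and D
    empty) and occurrence of A1 and A2 in two independent configurations (D the
    set of all bonds). *)
Definition occurrence_sharing (E : finType) (A1 A2 : pred {set E})
    (D w1 w2 : {set E}) : bool :=
  [exists S : {set E} * {set E},
     [&& S.1 \subset w1, S.2 \subset w2, A1 S.1, A2 S.2
       & S.1 :&: S.2 \subset D]].

Lemma occurrence_sharingS (E : finType) (A1 A2 : pred {set E})
    (D D' w1 w1' w2 w2' : {set E}) :
  D \subset D' -> w1 \subset w1' -> w2 \subset w2' ->
  occurrence_sharing A1 A2 D w1 w2 -> occurrence_sharing A1 A2 D' w1' w2'.
Proof.
move=> DD' ww1 ww2 /existsP[S /and5P[S1 S2 AS1 AS2 dS]]; apply/existsP.
exists S; rewrite (subset_trans S1 ww1) (subset_trans S2 ww2) AS1 AS2.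
exact: subset_trans dS DD'.
Qed.

(** A bond outside D belongs to at most one of the two witnesses, so it can be
    withdrawn from one of the configurations. *)
Lemma occurrence_sharing_split (E : finType) (A1 A2 : pred {set E})
    (D w1 w2 : {set E}) (e : E) :
  e \notin D ->
  occurrence_sharing A1 A2 D (e |: w1) (e |: w2) ->
  occurrence_sharing A1 A2 D (e |: w1) w2
    || occurrence_sharing A1 A2 D w1 (e |: w2).
Proof.
move=> eD /existsP[S /and5P[S1 S2 AS1 AS2 dS]].
have subU1 (X Y : {set E}) : e \notin X -> X \subset e |: Y -> X \subset Y.
  by move=> eX XY; rewrite -(setD1K (setU11 e Y)) in XY;
    apply/subsetP => x xX; move/subsetP: XY => /(_ x xX); rewrite !inE;
    case: eqP => [xe|//]; rewrite -xe xX in eX.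
have [eS1|eS1] := boolP (e \in S.1); last first.
  by apply/orP; right; apply/existsP; exists S; rewrite subU1 // S2 AS1 AS2.
have eS2 : e \notin S.2.
  apply: contra eD => eS2; move/subsetP: dS; apply; by rewrite inE eS1.
by apply/orP; left; apply/existsP; exists S; rewrite S1 subU1 // AS1 AS2.
Qed.

Lemma expect_split2 (T : finType) (R : realType) (B : {set {set T}}) (p : R)
    (e : {set T}) (F : {set {set T}} -> {set {set T}} -> R) :
  e \in B ->
  expect B p (fun w1 => expect B p (F w1)) =
  expect (B :\ e) p (fun w1 => expect (B :\ e) p (fun w2 =>
    p * (p * F (e |: w1) (e |: w2) + (1 - p) * F (e |: w1) w2)
    + (1 - p) * (p * F w1 (e |: w2) + (1 - p) * F w1 w2))).
Proof.
move=> eB; rewrite (expect_split _ _ eB); apply: eq_expect => w1 _.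
by rewrite 2!(expect_split _ _ eB) -2!expectZ -expectD.
Qed.

(** The effect of doubling one bond, all the others being fixed. The variables x
    tell whether the events occur when a single copy of the bond is open or
    closed, the variables y do so for the four states of two independent copies.
    If the single copy must be open, then one of the two copies being open
    suffices, which already has probability p. *)
Lemma doubling_bond (R : realFieldType) (p : R)
    (x1 x0 y11 y10 y01 y00 : bool) :
  0 <= p <= 1 ->
  (x1 -> y10 || y01) -> (x0 -> y00) -> (y00 -> y10) -> (y00 -> y01) ->
  (y10 -> y11) -> (y01 -> y11) ->
  p * (p * x1%:R + (1 - p) * x1%:R) + (1 - p) * (p * x0%:R + (1 - p) * x0%:R)
  <= p * (p * y11%:R + (1 - p) * y10%:R)
     + (1 - p) * (p * y01%:R + (1 - p) * y00%:R).
Proof.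
move=> /andP[p0 p1] hx1 hx0 h10 h01 h1 h1'.
have pp : 0 <= p * p by rewrite mulr_ge0.
have pq : 0 <= p * (1 - p) by rewrite mulr_ge0 // subr_ge0.
case: x0 hx0 => [/(_ isT) y00T|_].
  rewrite y00T (h10 y00T) (h01 y00T) (h1 (h10 y00T)); case: x1 {hx1} => /=; lra.
(* From here on the value of y00 matters only through its sign. *)
have qq : 0 <= (1 - p) * (1 - p) * y00%:R by rewrite !mulr_ge0 // subr_ge0.
move: qq {h10 h01}; move: y00%:R => r qq.
case: x1 hx1 => [/(_ isT)/orP[y10T|y01T]|_].
- rewrite (h1 y10T) y10T; case: y01 {h1'} => /=; lra.
- rewrite (h1' y01T) y01T; case: y10 {h1} => /=; lra.
- by case: y11 {h1 h1'}; case: y10; case: y01 => /=; lra.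
Qed.

Section BergKesten.

Variables (T : finType) (R : realType) (B : {set {set T}}) (p : R).
Hypothesis p01 : 0 <= p <= 1.
Variables A1 A2 : pred {set {set T}}.

(** The second configuration has its own copy of the bonds of D and shares the
    others with the first one. *)
Let mix (D w1 w2 : {set {set T}}) := (w2 :&: D) :|: (w1 :\: D).

Let doubled (D : {set {set T}}) : R :=
  expect B p (fun w1 => expect B p (fun w2 =>
    (occurrence_sharing A1 A2 D w1 (mix D w1 w2))%:R)).

Lemma le_doubled (D : {set {set T}}) e :
  e \in B -> e \notin D -> doubled D <= doubled (e |: D).
Proof.
move=> eB eD; rewrite /doubled 2!(expect_split2 _ _ eB).
apply: (le_expect p01) => w1; rewrite subsetD1 => /andP[_ ew1].
apply: (le_expect p01) => w2; rewrite subsetD1 => /andP[_ ew2].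
set m := mix D w1 w2.
have mixE : [/\ mix D (e |: w1) (e |: w2) = e |: m, mix D (e |: w1) w2 = e |: m
    & mix D w1 (e |: w2) = m].
  by split; apply/setP => x; rewrite !inE;
    case: (x =P e) => [->|//]; rewrite (negbTE eD) ?(negbTE ew1) //= ?andbF.
have mixE' : [/\ mix (e |: D) (e |: w1) (e |: w2) = e |: m,
    mix (e |: D) (e |: w1) w2 = m, mix (e |: D) w1 (e |: w2) = e |: m
    & mix (e |: D) w1 w2 = m].
  by split; apply/setP => x; rewrite !inE;
    case: (x =P e) => [->|//];
    rewrite (negbTE eD) ?(negbTE ew1) ?(negbTE ew2) //= ?andbF.
have [-> -> ->] := mixE; have [-> -> -> ->] := mixE'.
have DD : D \subset e |: D by apply: subsetUr.
have U1 := subsetUr [set e] w1; have Um := subsetUr [set e] m.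
apply: doubling_bond => //.
- move=> /(occurrence_sharing_split eD)/orP[] h; apply/orP; [left|right];
    exact: occurrence_sharingS h.
- exact: occurrence_sharingS.
- exact: occurrence_sharingS.
- exact: occurrence_sharingS.
- exact: occurrence_sharingS.
- exact: occurrence_sharingS.
Qed.

(** The van den Berg-Kesten inequality. Doubling the bonds one after the other
    can only increase the probability that A1 has a witness in the first copy and
    A2 one in the second copy which share doubled bonds only; once all the bonds
    are doubled, the two events are independent. *)
Theorem berg_kesten :
  increasing_event A1 -> increasing_event A2 ->
  prob B p (disjoint_occurrence A1 A2) <= prob B p A1 * prob B p A2.
Proof.
move=> A1incr A2incr.
have le0 (D : {set {set T}}) : D \subset B -> doubled set0 <= doubled D.
  elim/setD1_ind: D => [//|D e eD IH DB].
  rewrite -(setD1K eD).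
  apply: le_trans (IH (subset_trans (subD1set _ _) DB)) (le_doubled _ _).
    exact: (subsetP DB).
  by rewrite !inE eqxx.
have -> : prob B p (disjoint_occurrence A1 A2) = doubled set0.
  rewrite prob_expect; apply: eq_expect => w _.
  under eq_expect do rewrite /mix setI0 set0U setD0.
  rewrite expect_cst /occurrence_sharing /disjoint_occurrence.
  congr (nat_of_bool _)%:R; apply: eq_existsb => S.
  by rewrite subset0 setI_eq0.
apply: le_trans (le0 B (subxx _)) _.
rewrite !prob_expect -expectZr; apply: (le_expect p01) => w1 w1B.
rewrite -expectZ; apply: (le_expect p01) => w2 w2B.
rewrite /mix (setIidPl w2B) (_ : w1 :\: B = set0) ?setU0; last first.
  by apply/eqP; rewrite setD_eq0.
rewrite -natrM ler_nat.
case: (boolP (occurrence_sharing _ _ _ _ _)) => // /existsP[S].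
by move=> /and5P[S1 S2 /(A1incr _ _ S1)-> /(A2incr _ _ S2)->].
Qed.

End BergKesten.

(** * Connectivity and disjoint paths *)

Section Connectivity.

Variable T : finType.
Implicit Types (w : {set {set T}}) (P A : {set T}) (x y z u v : T).

Lemma adj_sym w x y : adj w x y = adj w y x.
Proof. by rewrite /adj setUC. Qed.

Lemma connect_adj_sym w x y : connect (adj w) x y = connect (adj w) y x.
Proof. by apply: sym_connect_sym => {}x {}y; exact: adj_sym. Qed.

Lemma connect_increasing x y :
  increasing_event (fun w => connect (adj w) x y).
Proof.
move=> w w' ww'; apply: connect_sub => {}x {}y xy.
by apply: connect1; apply: (subsetP ww').
Qed.

Lemma connect_stable w (Q : pred T) x y :
  (forall z t, Q z -> adj w z t -> Q t) -> Q x -> connect (adj w) x y -> Q y.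
Proof.
move=> Qadj Qx /connectP[p pxp ->]; elim: p x Qx pxp => //= z p IH x Qx.
by move=> /andP[xz]; apply: IH; apply: Qadj xz.
Qed.

(** Exploring a cluster reads only the bonds that touch it. *)
Lemma eq_cluster w w' u :
  (forall x y, x \in cluster w u -> adj w x y = adj w' x y) ->
  cluster w u = cluster w' u.
Proof.
move=> eqw; apply/setP => y; rewrite [in LHS]inE [in RHS]inE; apply/idP/idP => uy.
  suff /andP[] : (y \in cluster w u) && connect (adj w') u y by [].
  apply: (connect_stable
    (Q := fun t => (t \in cluster w u) && connect (adj w') u t)) uy; last first.
    by rewrite inE !connect0.
  move=> z t /andP[uz uz'] zt; rewrite (connect_trans uz') ?connect1 -?eqw //.
  by rewrite inE andbT; rewrite inE in uz; apply: connect_trans uz (connect1 zt).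
apply: (connect_stable (Q := connect (adj w) u)) uy; last exact: connect0.
by move=> z t uz zt; rewrite (connect_trans uz) // connect1 // eqw // inE.
Qed.

(** Witnesses of connections are described by sets of vertices rather than of
    bonds: two sets of vertices that share a single vertex contain no common
    bond, since a bond has two ends. *)
Definition inside w P := [set b in w | b \subset P].

Lemma insideS w P P' : P \subset P' -> inside w P \subset inside w P'.
Proof.
by move=> PP; apply/subsetP => b; rewrite !inE => /andP[-> /subset_trans->].
Qed.

Lemma inside_sub w P : inside w P \subset w.
Proof. by apply/subsetP => b; rewrite inE => /andP[]. Qed.

Lemma connect_inside w P x p :
  path (adj w) x p -> {subset x :: p <= P} ->
  connect (adj (inside w P)) x (last x p).
Proof.
move=> pxp pP; apply/connectP; exists p => //.
elim: p x pxp pP => //= y p IH x /andP[xy yp] pP; rewrite IH //; last first.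
  by move=> z zp; apply: pP; rewrite inE zp orbT.
rewrite andbT /adj inE; apply/andP; split; first exact: xy.
by apply/subsetP => z; rewrite !inE => /orP[]/eqP->; apply: pP;
  rewrite !inE eqxx ?orbT.
Qed.

Lemma inside_disjoint w P P' z :
  is_bond_set w -> P :&: P' \subset [set z] ->
  [disjoint inside w P & inside w P'].
Proof.
move=> w2 PPz; apply/pred0P => b /=; rewrite !inE; apply/negP.
move=> /andP[/andP[bw bP] /andP[_ bP']].
have /subset_leq_card : b \subset [set z].
  by apply: subset_trans PPz; rewrite subsetI bP.
by rewrite cards1 w2.
Qed.

Lemma connect_first_hit w (Q : pred T) x y :
  connect (adj w) x y -> Q y ->
  exists2 z, Q z & connect (adj (inside w [set t | (t == z) || ~~ Q t])) x z.
Proof.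
move=> /connectP[p pxp ->] Qy.
suff [z [Qz _ xz]] : exists z, [/\ Q z, (x == z) || ~~ Q x &
    connect (adj (inside w [set t | (t == z) || ~~ Q t])) x z] by exists z.
elim: p x pxp Qy => [|y' p IH] x /=; first by exists x; rewrite eqxx connect0.
move=> /andP[xy /IH{}IH] /IH[z [Qz yz cyz]].
have [Qx|nQx] := boolP (Q x); first by exists x; rewrite eqxx connect0.
exists z; rewrite Qz orbT; split=> //; apply: connect_trans cyz.
apply: connect1; rewrite /adj inE; apply/andP; split; first exact: xy.
by apply/subsetP => t; rewrite !inE => /orP[]/eqP->; rewrite ?nQx ?orbT.
Qed.

Lemma simple_path w x y :
  connect (adj w) x y ->
  exists p, [/\ path (adj w) x p, uniq (x :: p) & last x p = y].
Proof.
by move=> /connectP[p /shortenP[q xq uq _] ->]; exists q.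
Qed.

Lemma simple_path_split w x p z :
  path (adj w) x p -> uniq (x :: p) -> z \in x :: p ->
  exists P1 P2, [/\ P1 :&: P2 \subset [set z], P1 :|: P2 \subset [set t in x :: p],
    connect (adj (inside w P1)) x z & connect (adj (inside w P2)) z (last x p)].
Proof.
move=> pxp up /splitPl zp; case: zp pxp up => p1 p2 lz.
rewrite cat_path lz last_cat lz -cat_cons cat_uniq => /andP[pp1 pp2].
move=> /and3P[_ /hasPn up _].
exists [set t in x :: p1], [set t in z :: p2]; split.
- apply/subsetP => t /setIP[]; rewrite !in_set => tp1.
  by rewrite in_cons in_set1 => /orP[//|/up/negP[]].
- apply/subsetP => t /setUP[]; rewrite !in_set mem_cat; first by move=> ->.
  rewrite in_cons => /orP[/eqP->|->]; last by rewrite orbT.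
  by rewrite -lz mem_last.
- by rewrite -lz; apply: connect_inside => // t; rewrite in_set.
- by apply: connect_inside => // t; rewrite in_set.
Qed.

(** A simple path from v to y which meets A is cut at a vertex of A. *)
Lemma disjoint_occurrence_avoid w A v y :
  is_bond_set w -> connect (adj w) v y ->
  ~~ connect (adj (inside w (~: A))) v y ->
  exists2 a, a \in A &
    disjoint_occurrence (fun w => connect (adj w) v a)
      (fun w => connect (adj w) a y) w.
Proof.
move=> w2 /simple_path[p [vp up py]] nvy.
have [/hasP[a ap aA]|nA] := boolP (has (mem A) (v :: p)); last first.
  case/negP: nvy; rewrite -py; apply: connect_inside => // t tp.
  by rewrite inE; apply: (hasPn nA).
exists a => //; have [P1 [P2 [P12 _ c1 c2]]] := simple_path_split vp up ap.
apply/existsP; exists (inside w P1, inside w P2) => /=.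
by rewrite !inside_sub c1 -py c2 (inside_disjoint w2 P12).
Qed.

(** Take a simple path from u to a, and follow a path from x until it first
    hits it, at z: the two parts of the first path and this initial segment of
    the second one pairwise share the vertex z only. *)
Lemma disjoint_occurrence_tree w u a x :
  is_bond_set w -> connect (adj w) u a -> connect (adj w) u x ->
  exists z,
    disjoint_occurrence (fun w => connect (adj w) u z)
      (disjoint_occurrence (fun w => connect (adj w) z a)
         (fun w => connect (adj w) z x)) w.
Proof.
move=> w2 /simple_path[p [vp up pa]].
rewrite connect_adj_sym => /(connect_first_hit (Q := mem (u :: p))).
move=> /(_ (mem_head _ _))[z zp]; set P3 := [set t | _].
rewrite connect_adj_sym => c3; exists z.
have [P1 [P2 [P12 P12p c1 c2]]] := simple_path_split vp up zp.
have P3E t : t \in P1 :|: P2 -> t \in P3 -> t == z.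
  move=> /(subsetP P12p); rewrite [_ \in [set _ in _]]in_set => tp.
  by rewrite in_set /= tp orbF.
have S2 : inside w P2 \subset inside w (P2 :|: P3) := insideS _ (subsetUl _ _).
have S3 : inside w P3 \subset inside w (P2 :|: P3) := insideS _ (subsetUr _ _).
apply/existsP; exists (inside w P1, inside w (P2 :|: P3)) => /=.
rewrite !inside_sub c1 (@inside_disjoint w P1 (P2 :|: P3) z w2) //= ?andbT.
  apply/existsP; exists (inside w P2, inside w P3) => /=.
  rewrite S2 S3 -pa c2 c3 (@inside_disjoint w P2 P3 z w2) //.
  by apply/subsetP => t /setIP[t2 t3]; rewrite in_set1 P3E // inE t2 orbT.
apply/subsetP => t /setIP[t1 /setUP[t2|t3]].
  by apply: (subsetP P12); rewrite inE t1.
by rewrite in_set1 P3E // inE t1.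
Qed.

Lemma eq_set2 x y u v :
  [set x; y] = [set u; v] -> (x = u /\ y = v) \/ (x = v /\ y = u).
Proof.
move=> /setP eqS.
have := eqS x; have := eqS y; have := eqS u; have := eqS v.
rewrite !inE !eqxx ?orbT /= => hv hu /esym/orP[]/eqP hy /esym/orP[]/eqP hx.
- by subst; move: hv; rewrite orbb => /eqP ->; left.
- by right.
- by left.
- by subst; move: hu; rewrite orbb => /eqP ->; left.
Qed.

Lemma connect_setU1 w u v x y :
  connect (adj ([set u; v] |: w)) x y =
  [|| connect (adj w) x y, connect (adj w) x u && connect (adj w) v y
    | connect (adj w) x v && connect (adj w) u y].
Proof.
have ww' := subsetUr [set [set u; v]] w.
have uv : connect (adj ([set u; v] |: w)) u v.
  by apply: connect1; rewrite /adj setU11.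
apply/idP/idP; last first.
  case/or3P => [|/andP[xu vy]|/andP[xv uy]]; first exact: connect_increasing.
    apply: connect_trans (connect_increasing ww' xu) _.
    exact: connect_trans uv (connect_increasing ww' vy).
  apply: connect_trans (connect_increasing ww' xv) _.
  rewrite connect_adj_sym in uv.
  exact: connect_trans uv (connect_increasing ww' uy).
pose Q t := [|| connect (adj w) x t, connect (adj w) x u && connect (adj w) v t
    | connect (adj w) x v && connect (adj w) u t].
apply: (connect_stable (Q := Q)); last by rewrite /Q connect0.
rewrite /Q => z t Qz; rewrite /adj in_setU1 => /orP[/eqP/eq_set2|zt].
  case=> [[zu tv]|[zv tu]]; subst z t.
    by case/or3P: Qz => [->|/andP[->]|/andP[->]]; rewrite ?connect0 ?orbT.
  by case/or3P: Qz => [->|/andP[->]|/andP[->]]; rewrite ?connect0 ?orbT.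
have ct a : connect (adj w) a z -> connect (adj w) a t.
  by move=> az; apply: connect_trans az (connect1 zt).
by case/or3P: Qz => [/ct->//|/andP[-> /ct->]|/andP[-> /ct->]]; rewrite !orbT.
Qed.

Lemma card_cluster_sum w x :
  #|cluster w x| = (\sum_y connect (adj w) x y)%N.
Proof.
by rewrite -sum1_card big_mkcond; apply: eq_bigr => y _; rewrite inE; case: connect.
Qed.

(** Opening the bond uv joins the clusters of u and v. If they were distinct, each
    vertex of one becomes connected to each vertex of the other, and the sum over
    x counts every such pair twice. *)
Lemma sum_card_cluster_setU1 w u v :
  (\sum_x #|cluster ([set u; v] |: w) x| = \sum_x #|cluster w x|
   + (v \notin cluster w u) * (#|cluster w u| * #|cluster w v|).*2)%N.
Proof.
rewrite inE; case: (boolP (connect (adj w) u v)) => [uv|nuv] /=.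
  rewrite mul0n addn0; apply: eq_bigr => x _; congr #|pred_of_set _|.
  apply/setP => y; rewrite !inE connect_setU1 orb_idr // => /orP[]/andP[].
    by move=> xu; apply: connect_trans; apply: connect_trans xu uv.
  rewrite connect_adj_sym in uv.
  by move=> xv; apply: connect_trans; apply: connect_trans xv uv.
have prodE a b : (#|cluster w a| * #|cluster w b|
    = \sum_x \sum_y (connect (adj w) x a && connect (adj w) b y))%N.
  rewrite [X in (X * _)%N]card_cluster_sum big_distrl; apply: eq_bigr => x _ /=.
  rewrite card_cluster_sum big_distrr; apply: eq_bigr => y _ /=.
  by rewrite mulnb [connect _ a x]connect_adj_sym.
rewrite mul1n -addnn [X in (_ + (_ + X))%N]mulnC !prodE -!big_split.
apply: eq_bigr => x _; rewrite !card_cluster_sum -!big_split.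
apply: eq_bigr => y _ /=; rewrite connect_setU1.
have tr a b c : connect (adj w) a b -> connect (adj w) b c ->
    connect (adj w) a c by exact: connect_trans.
have sy := connect_adj_sym w.
case: (boolP (connect (adj w) x y)) => xy /=.
  have -> : connect (adj w) x u && connect (adj w) v y = false.
    apply: contraNF nuv => /andP[xu vy].
    by apply: tr (tr _ _ _ _ xy) _; rewrite sy.
  have -> // : connect (adj w) x v && connect (adj w) u y = false.
  apply: contraNF nuv => /andP[xv uy].
  by rewrite sy in xy; apply: tr (tr _ _ _ uy xy) _.
case: (boolP (connect (adj w) x u && _)) => [/andP[xu vy]|_] //=.
have -> // : connect (adj w) x v && connect (adj w) u y = false.
apply: contraNF nuv => /andP[xv _]; rewrite sy in xu; exact: tr xu xv.
Qed.

End Connectivity.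

(** * Cluster exploration and the two diagrammatic bounds *)

Definition meeting (T : finType) (A : {set T}) : {set {set T}} :=
  [set b : {set T} | ~~ [disjoint b & A]].

Lemma setD_meeting (T : finType) (w : {set {set T}}) (A : {set T}) :
  w :\: meeting A = inside w (~: A).
Proof. by apply/setP => b; rewrite !inE negbK disjoints_subset andbC. Qed.

Section Exploration.

Variables (T : finType) (u v : T).
Implicit Types (w : {set {set T}}) (A : {set T}).

Let e : {set T} := [set u; v].

(** The cluster of u is A when A is connected to u and no open bond leaves A, and
    both conditions concern bonds with an end in A. *)
Lemma cluster_meeting w A :
  (cluster (w :\ e) u == A) = (cluster ((w :&: meeting A) :\ e) u == A).
Proof.
have adjE x y : x \in A -> adj (w :\ e) x y = adj ((w :&: meeting A) :\ e) x y.
  move=> xA; rewrite /adj !in_setD1 in_setI; case: (_ \in w); rewrite ?andbF //=.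
  rewrite andbT inE; have -> : ~~ [disjoint [set x; y] & A]; last by rewrite andbT.
  by apply/pred0Pn; exists x; rewrite /= !inE eqxx.
by apply/eqP/eqP => CA; rewrite -[RHS]CA; symmetry; apply: eq_cluster => x y;
  rewrite CA => /adjE.
Qed.

(** Once the cluster of u is known to be A, no open bond other than uv joins A to
    its complement, and uv is not inside the complement either. Hence the
    cluster of v is read off the bonds inside the complement, and uv may be
    forgotten. *)
Lemma cluster_avoiding w A :
  cluster (w :\ e) u = A -> v \notin A ->
  cluster (w :\ e) v = cluster (inside w (~: A)) v.
Proof.
move=> CA vA.
have uA : u \in A by rewrite -CA inE connect0.
have stepA x y : adj (w :\ e) x y -> x \in A -> y \in A.
  by move=> xy; rewrite -CA !inE => ux; apply: connect_trans ux (connect1 xy).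
apply: eq_cluster => x y; rewrite inE connect_adj_sym => vx.
have xA : x \notin A.
  apply: contra vA => xA; move: vx; rewrite connect_adj_sym connect_adj_sym.
  by apply: (connect_stable (Q := fun t => t \in A)) => // z t zA /stepA; apply.
apply/idP/idP => [xy|].
  rewrite /adj inE; move: (xy); rewrite /adj in_setD1 => /andP[_ ->] /=.
  apply/subsetP => z; rewrite !inE => /orP[]/eqP-> //.
  by apply: contra xA; apply: stepA; rewrite adj_sym.
rewrite /adj in_set in_setD1 => /andP[xyw xyA]; rewrite xyw andbT.
apply: contraTneq uA => xye; rewrite -in_setC; apply: (subsetP xyA).
by rewrite xye !inE eqxx.
Qed.

Lemma cluster_setD1 w :
  v \notin cluster w u -> cluster (w :\ e) u = cluster w u.
Proof.
move=> vC; apply/esym/eq_cluster => x y xC; rewrite /adj in_setD1.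
case: (boolP ([set x; y] \in w)) => xyw; rewrite ?andbF // andbT.
apply/esym; apply: contra vC => /eqP/eq_set2[[xu yv]|[xv yu]]; last by rewrite -xv.
by rewrite inE -yv -xu connect1.
Qed.

Lemma clusterS w w' x : w \subset w' -> cluster w x \subset cluster w' x.
Proof.
by move=> ww'; apply/subsetP => y; rewrite !inE; apply: connect_increasing.
Qed.

End Exploration.

Lemma natr_sum_bool_card (R : realType) (T : finType) (A : {set T}) :
  #|A|%:R = \sum_x (x \in A)%:R :> R.
Proof.
by rewrite -sum1_card natr_sum big_mkcond; apply: eq_bigr => x _; case: (x \in A).
Qed.

Section Inequalities.

Variables (T : finType) (R : realType) (B : {set {set T}}) (p : R).
Hypothesis hB : is_bond_set B.
Hypothesis p01 : 0 <= p <= 1.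
Implicit Types (x y z u v a : T) (A : {set T}).

Local Notation tau := (tau B p).
Local Notation chi x := (chi B x p).

Let bond_setS (w : {set {set T}}) : w \subset B -> is_bond_set w.
Proof. by move=> wB b /(subsetP wB)/hB. Qed.

Lemma tau_ge0 x y : 0 <= tau x y. Proof. exact: prob_ge0. Qed.

Lemma tauxx x : tau x x = 1.
Proof.
rewrite /Defs.tau prob_expect -[RHS](expect_cst p B); apply: eq_expect => w _.
by rewrite connect0.
Qed.

Lemma tau_sym x y : tau x y = tau y x.
Proof.
rewrite /Defs.tau !prob_expect; apply: eq_expect => w _.
by rewrite connect_adj_sym.
Qed.

Lemma chi_tau x : chi x = \sum_y tau x y.
Proof.
rewrite /Defs.chi; under eq_expect do rewrite natr_sum_bool_card.
rewrite expect_sum; apply: eq_bigr => y _; rewrite /Defs.tau prob_expect.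
by apply: eq_expect => w _; rewrite inE.
Qed.

Lemma chi_ge0 x : 0 <= chi x.
Proof. by rewrite chi_tau sumr_ge0 // => y _; apply: tau_ge0. Qed.

Lemma disjoint_connection_le x y z :
  prob B p (disjoint_occurrence (fun w => connect (adj w) x y)
              (fun w => connect (adj w) y z)) <= tau x y * tau y z.
Proof. by apply: berg_kesten => //; apply: connect_increasing. Qed.

(** The Aizenman-Newman bound. A connection from v to y that is lost when A is
    forbidden splits at some a in A into disjoint connections from v to a and
    from a to y, and the van den Berg-Kesten inequality factorizes their
    probability. *)
Lemma chi_avoiding A v :
  chi v - \sum_(a in A) tau v a * chi a
    <= expect B p (fun w => #|cluster (inside w (~: A)) v|%:R).
Proof.
rewrite lerBlDr.
under [in leRHS]eq_bigr do rewrite chi_tau mulr_sumr.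
apply: (@le_trans _ _ (expect B p (fun w => #|cluster (inside w (~: A)) v|%:R
  + \sum_(a in A) \sum_y (disjoint_occurrence (fun w => connect (adj w) v a)
      (fun w => connect (adj w) a y) w)%:R))).
  apply: (le_expect p01) => w wB; rewrite !natr_sum_bool_card exchange_big.
  rewrite -big_split; apply: ler_sum => y _ /=; rewrite !inE.
  have [vy|] := boolP (connect (adj w) v y); last first.
    by move=> _; rewrite addr_ge0 ?sumr_ge0.
  have [_|nvy] := boolP (connect (adj (inside w (~: A))) v y).
    by rewrite lerDl sumr_ge0.
  have [a aA ay] := disjoint_occurrence_avoid (bond_setS wB) vy nvy.
  by rewrite add0r (bigD1 a) //= ay lerDl sumr_ge0.
rewrite expectD lerD2l expect_sum; apply: ler_sum => a _.
rewrite expect_sum; apply: ler_sum => y _.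
by rewrite -prob_expect; apply: disjoint_connection_le.
Qed.

(** The tree-graph inequality, obtained from the branching vertex z by applying the
    van den Berg-Kesten inequality twice, and then summed over the vertices of the
    cluster, which gives the factor chi z. *)
Lemma tree_graph u a :
  expect B p (fun w => (a \in cluster w u)%:R * #|cluster w u|%:R)
    <= \sum_z tau u z * tau z a * chi z.
Proof.
under [leRHS]eq_bigr do rewrite chi_tau mulr_sumr.
rewrite exchange_big /=.
apply: (@le_trans _ _ (expect B p (fun w => \sum_x \sum_z
   (disjoint_occurrence (fun w => connect (adj w) u z)
      (disjoint_occurrence (fun w => connect (adj w) z a)
         (fun w => connect (adj w) z x)) w)%:R))).
  apply: (le_expect p01) => w wB; rewrite natr_sum_bool_card mulr_sumr.
  apply: ler_sum => x _; rewrite !inE -natrM mulnb.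
  case: (boolP (_ && _)) => [/andP[ua ux]|_]; last by rewrite sumr_ge0.
  have [z hz] := disjoint_occurrence_tree (bond_setS wB) ua ux.
  by rewrite (bigD1 z) //= hz lerDl sumr_ge0.
rewrite expect_sum; apply: ler_sum => x _.
rewrite expect_sum; apply: ler_sum => z _; rewrite -prob_expect -mulrA.
have bk := berg_kesten B p01 (@connect_increasing _ u z)
  (@disjoint_occurrence_increasing _ (fun w => connect (adj w) z a)
     (fun w => connect (adj w) z x)).
apply: (le_trans bk); rewrite ler_wpM2l ?tau_ge0 //.
exact: (berg_kesten B p01 (@connect_increasing _ z a) (@connect_increasing _ z x)).
Qed.

End Inequalities.

(** * Pivotal pairs of a bond *)

(** The expected number of pairs of vertices, the first one connected to u and the
    second one to v, for which the bond uv is pivotal. *)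
Definition pivotal_pairs (T : finType) (R : realType) (B : {set {set T}})
    (p : R) (u v : T) : R :=
  expect B p (fun w =>
    (v \notin cluster (w :\ [set u; v]) u)%:R
    * (#|cluster (w :\ [set u; v]) u|%:R * #|cluster (w :\ [set u; v]) v|%:R)).

Section PivotalPairs.

Variables (T : finType) (R : realType) (B : {set {set T}}) (p : R).
Hypothesis hB : is_bond_set B.
Hypothesis p01 : 0 <= p <= 1.
Variable X : R.
Hypothesis hchi : forall x, chi B x p = X.
Variables u v : T.

Let e : {set T} := [set u; v].

Local Notation tau := (tau B p).

Let law (A : {set T}) : R :=
  expect B p (fun w => (cluster (w :\ e) u == A)%:R).

Let law_ge0 A : 0 <= law A.
Proof. by apply: expect_ge0 => // w _; rewrite ler0n. Qed.

Let sum_law (h : {set T} -> R) :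
  \sum_A law A * h A = expect B p (fun w => h (cluster (w :\ e) u)).
Proof.
under eq_bigr do rewrite -expectZr.
rewrite -expect_sum; apply: eq_expect => w _.
rewrite (bigD1 (cluster (w :\ e) u)) //= eqxx mul1r big1 ?addr0 // => A nA.
by rewrite eq_sym (negbTE nA) mul0r.
Qed.

(** The cluster of u off the bond uv is explored first. If it equals A, the
    bonds inside the complement of A have not been looked at, and the cluster of
    v is a fresh percolation cluster there. *)
Lemma pivotal_pairs_explore :
  pivotal_pairs B p u v = \sum_(A : {set T} | v \notin A) law A *
    (#|A|%:R * expect B p (fun w => #|cluster (inside w (~: A)) v|%:R)).
Proof.
transitivity (expect B p (fun w => \sum_(A : {set T} | v \notin A)
    (cluster (w :\ e) u == A)%:R
    * (#|A|%:R * #|cluster (inside w (~: A)) v|%:R))).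
  apply: eq_expect => w _; rewrite -/e; set C := cluster (w :\ e) u.
  have [vC|vC] := boolP (v \in C).
    rewrite mul0r big1 // => A vA; case: eqP => [CA|_]; last by rewrite mul0r.
    by rewrite -CA vC in vA.
  rewrite mul1r (bigD1 C) //= eqxx mul1r -(cluster_avoiding (w := w) (u := u)) //.
  rewrite big1 ?addr0 // => A /andP[_ nA].
  by rewrite eq_sym (negbTE nA) mul0r.
rewrite expect_sum; apply: eq_bigr => A _.
under eq_expect do rewrite mulrCA -setD_meeting cluster_meeting.
rewrite expectZ (expect_indep p B (meeting A)
  (fun w => (cluster (w :\ e) u == A)%:R) (fun w => #|cluster w v|%:R)).
rewrite mulrCA; congr (_ * (_ * _)).
  by apply: eq_expect => w _; rewrite -cluster_meeting.
by apply: eq_expect => w _; rewrite setD_meeting.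
Qed.

(** Forbidding A can only decrease the cluster of v. *)
Lemma pivotal_pairs_le : pivotal_pairs B p u v <= X ^+ 2.
Proof.
have X0 : 0 <= X by rewrite -(hchi u) chi_ge0.
rewrite pivotal_pairs_explore.
apply: (@le_trans _ _ (\sum_A law A * (#|A|%:R * X))).
  rewrite [leRHS](bigID (fun A : {set T} => v \notin A)) /= -[leLHS]addr0.
  apply: lerD; last by rewrite sumr_ge0 // => A _; rewrite !mulr_ge0.
  apply: ler_sum => A _; rewrite ler_wpM2l // ler_wpM2l // -(hchi v).
  apply: (le_expect p01) => w _; rewrite ler_nat subset_leq_card //.
  exact/clusterS/inside_sub.
rewrite sum_law expectZr expr2 ler_wpM2r // -(hchi u).
apply: (le_expect p01) => w _; rewrite ler_nat subset_leq_card //.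
by rewrite clusterS // subD1set.
Qed.

(** By [chi_avoiding], the fresh cluster of v in the complement of A has mean size at
    least X (1 - S A), where S A is the sum of tau v a over a in A. It remains to
    bound from below the mean of f C = #|C| (1 - S C), with C the cluster of u off
    the bond uv. Replacing C by the full cluster of u, which would be the wrong
    direction for #|C| alone, does not increase f: if the clusters differ, the full
    one contains v, so that S >= tau v v = 1 and f <= 0 there; and if f was already
    negative, both #|C| and S - 1 have grown. The tree-graph inequality
    then yields the triangle diagram. *)
Lemma pivotal_pairs_ge : X ^+ 2 * (1 - nabla B p u v) <= pivotal_pairs B p u v.
Proof.
have X0 : 0 <= X by rewrite -(hchi u) chi_ge0.
have t0 := tau_ge0 B p01.
pose S (A : {set T}) := \sum_(a in A) tau v a.
have S_le (A C : {set T}) : A \subset C -> S A <= S C.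
  move=> /subsetP AC; rewrite /S [leRHS](big_mkcond) [leLHS]big_mkcond.
  apply: ler_sum => a _; case: ifP => [/AC->//|_]; case: ifP => // _; exact: t0.
have S_ge1 (A : {set T}) : v \in A -> 1 <= S A.
  by move=> vA; rewrite /S (bigD1 v) //= tauxx lerDl sumr_ge0.
pose f (A : {set T}) := #|A|%:R * (1 - S A).
(* The sets A that contain v are added back: their terms are nonpositive. *)
apply: (@le_trans _ _ (\sum_A law A * (f A * X))); last first.
  rewrite pivotal_pairs_explore (bigID (fun A : {set T} => v \notin A)) /=.
  rewrite -[leRHS]addr0; apply: lerD; last first.
    rewrite sumr_le0 // => A; rewrite negbK => /S_ge1 SA.
    by rewrite mulr_ge0_le0 // mulr_le0_ge0 // mulr_ge0_le0 // subr_le0.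
  apply: ler_sum => A vA; rewrite ler_wpM2l // /f -mulrA ler_wpM2l //.
  apply: le_trans (chi_avoiding hB p01 A v).
  rewrite hchi; under [in leRHS]eq_bigr do rewrite hchi.
  by rewrite -mulr_suml /S mulrBl mul1r.
rewrite sum_law expectZr expr2 -mulrA mulrC ler_wpM2r //.
(* Pass from the cluster of u off the bond uv to its full cluster. *)
apply: (@le_trans _ _ (expect B p (fun w => f (cluster w u)))); last first.
  apply: (le_expect p01) => w _.
  have [vC|/cluster_setD1 -> //] := boolP (v \in cluster w u).
  have CS : cluster (w :\ e) u \subset cluster w u by rewrite clusterS // subD1set.
  have := S_le _ _ CS; have := S_ge1 _ vC; rewrite /f.
  have := subset_leq_card CS; rewrite -(ler_nat R).
  move: (S _) (S _) => s s'; have : 0 <= #|cluster (w :\ e) u|%:R :> R by [].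
  by move: (#|_|%:R) (#|_|%:R) => n n'; nra.
have -> : expect B p (fun w => f (cluster w u)) = X - \sum_a tau v a *
    expect B p (fun w => (a \in cluster w u)%:R * #|cluster w u|%:R).
  rewrite -(hchi u); under [in RHS]eq_bigr do rewrite -expectZ.
  rewrite -expect_sum -expectB; apply: eq_expect => w _.
  rewrite /f mulrBr mulr1; congr (_ - _); rewrite /S big_mkcond mulr_sumr.
  apply: eq_bigr => a _; case: (a \in _); rewrite ?mulr0 ?mul0r ?mulr0 // mul1r.
  by rewrite mulrC.
rewrite mulrBr mulr1 lerD2l lerN2.
rewrite /nabla exchange_big mulr_sumr; apply: ler_sum => a _.
rewrite [tau v a]tau_sym [leRHS]mulr_sumr.
apply: le_trans (ler_wpM2l (t0 _ _) (tree_graph hB p01 u a)) _.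
rewrite mulr_sumr; apply: ler_sum => z _; rewrite hchi.
by rewrite le_eqVlt; apply/orP; left; apply/eqP; ring.
Qed.

End PivotalPairs.

(** * The susceptibility as a function of the parameter *)

(** If h' is between k1 h^2 and k2 h^2, then 1/h + k1 x is nonincreasing and
    1/h + k2 x is nondecreasing. *)
Lemma inv_growth (R : realType) (h h' : R -> R) (a b k1 k2 : R) :
  (forall x : R, is_derive x (1 : R) h (h' x)) -> a <= b ->
  (forall x, a <= x <= b -> 0 < h x) ->
  (forall x, a <= x <= b -> k1 * h x ^+ 2 <= h' x <= k2 * h x ^+ 2) ->
  k1 * (b - a) <= (h a)^-1 - (h b)^-1 <= k2 * (b - a).
Proof.
move=> dh ab h0 hh'.
pose g k x := (h x)^-1 + k * x.
have dg k x : a <= x <= b ->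
    is_derive x (1 : R) (g k) (- (h x) ^- 2 *: h' x + k *: (1 : R)).
  move=> xab; have hx0 : h x != 0 by rewrite gt_eqF // h0.
  have dV := is_deriveV hx0 (dh x).
  have dk := is_deriveZ k (is_derive_id x (1 : R)).
  exact: is_deriveD dV dk.
have dE k x : a <= x <= b -> derive1 (g k) x = k - h' x / h x ^+ 2.
  move=> /(dg k) dgx; rewrite derive1E derive_val /GRing.scale /= mulr1.
  by rewrite addrC mulNr mulrC.
have h2 x : a <= x <= b -> 0 < h x ^+ 2 by move=> /h0; exact: exprn_gt0.
have oc x : x \in `]a, b[ -> a <= x <= b.
  by rewrite in_itv /= => /andP[/ltW-> /ltW->].
have der k x : x \in `]a, b[ -> derivable (g k) x 1 by move=> /oc/(dg k)[].
have derc k x : x \in `[a, b] -> derivable (g k) x 1.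
  by rewrite in_itv /= => /(dg k)[].
apply/andP; split.
- suff : g k1 b <= g k1 a by rewrite /g; lra.
  apply: (ler0_derive1_nincr (der k1) _
    (derivable_within_continuous (derc k1))) => // x /oc xab.
  by rewrite dE // subr_le0 ler_pdivlMr ?h2 //; have /andP[] := hh' x xab.
- suff : g k2 a <= g k2 b by rewrite /g; lra.
  apply: (ger0_derive1_ndecr (der k2) _
    (derivable_within_continuous (derc k2))) => // x /oc xab.
  by rewrite dE // subr_ge0 ler_pdivrMr ?h2 //; have /andP[] := hh' x xab.
Qed.

Section Transitivity.

Variables (T : finType) (R : realType) (B : {set {set T}}).
Hypothesis hB : is_bond_set B.

Definition relabel (phi : T -> T) (w : {set {set T}}) : {set {set T}} :=
  [set phi @: b | b : {set T} in w].

Lemma relabel_bonds (phi : T -> T) :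
  injective phi ->
  (forall u v, [set u; v] \in B -> [set phi u; phi v] \in B) ->
  relabel phi B = B.
Proof.
move=> inj hphi; apply/eqP; rewrite eqEcard card_imset ?leqnn ?andbT; last first.
  exact: imset_inj.
apply/subsetP => _ /imsetP[b bB ->].
have /eqP/cards2P[x [y [_ bE]]] := hB bB.
by rewrite bE imsetU !imset_set1 hphi // -bE.
Qed.

Lemma expect_relabel (phi : T -> T) (p : R) (f : {set {set T}} -> R) :
  injective phi -> relabel phi B = B ->
  expect B p (fun w => f (relabel phi w)) = expect B p f.
Proof.
move=> inj phiB.
have Inj := imset_inj inj.
have INJ : injective (relabel phi) := imset_inj Inj.
rewrite /expect [RHS](reindex_inj INJ) /=; apply: eq_big => [w|w _].
  rewrite !powersetE; apply/idP/idP => [wB|/subsetP wB].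
    by rewrite -phiB; apply: imsetS.
  apply/subsetP => b bw; rewrite -(mem_imset _ _ Inj) -/(relabel phi B) phiB.
  exact/wB/imset_f.
congr (_ * _); rewrite /weight -[in RHS]phiB big_imset /=; last exact: in2W.
by apply: eq_bigr => b _; rewrite mem_imset.
Qed.

(** An automorphism maps the cluster of x into the cluster of its image in the
    relabelled configuration, which has the same law. The resulting inequality
    is symmetric in x and y by transitivity. *)
Lemma chi_transitive (p : R) (x y : T) :
  is_transitive B -> 0 <= p <= 1 -> chi B x p = chi B y p.
Proof.
move=> htrans p01.
suff le_chi (x' y' : T) : chi B x' p <= chi B y' p.
  by apply/eqP; rewrite eq_le !le_chi.
have [phi [/bij_inj inj hphi <-]] := htrans x' y'.
rewrite /chi -[leRHS](expect_relabel p _ inj (relabel_bonds inj hphi)).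
apply: (le_expect p01) => w _; rewrite ler_nat -(card_imset _ inj).
apply: subset_leq_card; apply/subsetP => _ /imsetP[z + ->]; rewrite !inE => xz.
apply: (connect_stable (Q := fun t =>
  connect (adj (relabel phi w)) (phi x') (phi t))) xz; last exact: connect0.
move=> s t ct st; apply: connect_trans ct (connect1 _).
rewrite /adj -!imset_set1 -imsetU; apply: imset_f; exact: st.
Qed.

Lemma sum_degree : (\sum_x degree B x = #|B|.*2)%N.
Proof.
transitivity (\sum_x \sum_(b in B) (x \in b))%N.
  apply: eq_bigr => x _; rewrite /degree -sum1_card big_mkcond [RHS]big_mkcond.
  by apply: eq_bigr => b _; rewrite inE; case: (b \in B); case: (x \in b).
rewrite exchange_big /= -muln2 -sum_nat_const; apply: eq_bigr => b bB.
by rewrite -(hB bB) -sum1_card [RHS]big_mkcond; apply: eq_bigr => x _; case: (x \in b).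
Qed.

End Transitivity.

Section DifferentialInequalities.

Variables (T : finType) (R : realType) (B : {set {set T}}) (o : T) (Omega : nat).
Hypothesis hB : is_bond_set B.
Hypothesis htrans : is_transitive B.
Hypothesis hOmega : forall x, degree B x = Omega.

(** Averaging over the starting point makes the effect of a bond symmetric in its
    two ends. This is a polynomial in q, hence differentiable on all of R, which
    agrees with chi on [0, 1] only. *)
Let mean_chi (q : R) : R :=
  #|T|%:R^-1 * expect B q (fun w => (\sum_x #|cluster w x|)%:R).

Let V0 : 0 < #|T|%:R :> R.
Proof. by rewrite ltr0n; apply/card_gt0P; exists o. Qed.

Let mean_chiE (q : R) : 0 <= q <= 1 -> mean_chi q = chi B o q.
Proof.
move=> q01; rewrite /mean_chi; under eq_expect do rewrite natr_sum.
rewrite expect_sum (eq_bigr (fun=> chi B o q)); last first.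
  by move=> x _; exact: (chi_transitive hB x o htrans q01).
by rewrite sumr_const -[chi B o q *+ _]mulr_natl mulKf // gt_eqF.
Qed.

Let gain (q : R) (b : {set T}) : R := expect B q (fun w =>
  (\sum_x #|cluster (b |: w) x|)%:R - (\sum_x #|cluster (w :\ b) x|)%:R).

Let is_derive_mean_chi (q : R) :
  is_derive q (1 : R) mean_chi (#|T|%:R^-1 * \sum_(b in B) gain q b).
Proof. exact: is_deriveZ _ (is_derive_expect B _ q). Qed.

Lemma gain_pivotal_pairs q (u v : T) :
  gain q [set u; v] = 2 * pivotal_pairs B q u v.
Proof.
rewrite -expectZ; apply: eq_expect => w _.
set e := [set u; v].
have -> : e |: w = e |: w :\ e.
  by apply/setP => b; rewrite !inE; case: eqP.
rewrite sum_card_cluster_setU1 natrD addrAC subrr add0r natrM -muln2 !natrM.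
by rewrite [2 * _]mulrC -!mulrA.
Qed.

Lemma chi_ge1 (q : R) : 0 <= q <= 1 -> 1 <= chi B o q.
Proof.
move=> q01; rewrite chi_tau (bigD1 o) //= tauxx lerDl sumr_ge0 // => y _.
exact: tau_ge0.
Qed.

Lemma nabla_le_param (q r : R) x y :
  0 <= q -> q <= r -> r <= 1 -> nabla B q x y <= nabla B r x y.
Proof.
move=> q0 qr r1.
have tau_le a b : tau B q a b <= tau B r a b.
  rewrite /tau !prob_expect; apply: le_expect_param => // w w' ww'.
  by rewrite ler_nat; have := @connect_increasing _ a b w w' ww';
    case: connect => // ->.
have t0 a b : 0 <= tau B q a b by rewrite tau_ge0 // q0 (le_trans qr).
apply: ler_sum => u _; apply: ler_sum => v _.
by rewrite !ler_pM ?mulr_ge0.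
Qed.

Lemma chi_le_param (q r : R) :
  0 <= q -> q <= r -> r <= 1 -> chi B o q <= chi B o r.
Proof.
move=> q0 qr r1; apply: le_expect_param => // w w' ww'.
by rewrite ler_nat subset_leq_card // clusterS.
Qed.

Lemma chi0 : chi B o 0 = 1 :> R.
Proof.
have E0 (C : {set {set T}}) f : expect C (0 : R) f = f set0.
  elim/setD1_ind: C f => [f|C e eC IH f]; first exact: expect0.
  by rewrite (expect_split _ _ eC) IH mul0r add0r subr0 mul1r.
rewrite /chi E0 (_ : cluster set0 o = [set o]) ?cards1 //.
apply/setP => y; rewrite !inE; apply/idP/eqP => [|->]; last exact: connect0.
move=> oy; apply/eqP.
by apply: (connect_stable (Q := pred1 o)) oy => //= z t _; rewrite /adj inE.
Qed.

(** The integrated form of the differential inequalities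
    (1 - c) Omega chi^2 <= chi' <= Omega chi^2. Russo's formula expresses #|T| chi' as
    the sum over the bonds of twice the pivotal pairs, and twice the number of
    bonds is Omega #|T|. The triangle diagram increases with the parameter, so
    the bound c at q serves on the whole interval. *)
Lemma chi_inv_increment (c p q : R) :
  0 <= p -> p <= q -> q <= 1 ->
  (forall x y, [set x; y] \in B -> nabla B q x y <= c) ->
  (1 - c) * Omega%:R * (q - p) <= (chi B o p)^-1 - (chi B o q)^-1
    <= Omega%:R * (q - p).
Proof.
move=> p0 pq q1 nab.
have r01 r : p <= r <= q -> 0 <= r <= 1 by move=> /andP[]; lra.
have pE : chi B o p = mean_chi p by rewrite mean_chiE // r01 // lexx.
have qE : chi B o q = mean_chi q by rewrite mean_chiE // r01 // lexx andbT.
have mean_gt0 r : p <= r <= q -> 0 < mean_chi r.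
  by move=> /r01 r1; rewrite mean_chiE // (lt_le_trans _ (chi_ge1 r1)).
have degE k : #|T|%:R^-1 * \sum_(b in B) (2 * k) = Omega%:R * k :> R.
  rewrite sumr_const -[_ *+ #|_|]mulr_natl [#|_|%:R * _]mulrA -natrM muln2.
  rewrite -(sum_degree hB) (eq_bigr _ (fun x _ => hOmega x)) sum_nat_const.
  by rewrite natrM -mulrA mulKf // gt_eqF.
have bondE b : b \in B -> exists u v, b = [set u; v].
  by move=> /hB/eqP/cards2P[u [v [_ ->]]]; exists u, v.
rewrite pE qE; apply: (inv_growth is_derive_mean_chi pq mean_gt0) => r rpq.
apply/andP; split.
  rewrite [_ * Omega%:R]mulrC -mulrA -degE ler_wpM2l ?invr_ge0 //.
  apply: ler_sum => b bB; have [u [v bE]] := bondE b bB; rewrite bE in bB *.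
  rewrite gain_pivotal_pairs ler_wpM2l // mean_chiE ?r01 //.
  have hchi x : chi B x r = chi B o r by apply: chi_transitive => //; apply: r01.
  apply: le_trans (pivotal_pairs_ge hB (r01 _ rpq) hchi u v).
  rewrite mulrC ler_wpM2l ?exprn_even_ge0 // lerD2l lerN2.
  move: rpq => /andP[pr rq].
  by rewrite (le_trans _ (nab u v bB)) // nabla_le_param // (le_trans p0).
rewrite -degE ler_wpM2l ?invr_ge0 //.
apply: ler_sum => b bB; have [u [v bE]] := bondE b bB; rewrite bE.
rewrite gain_pivotal_pairs ler_wpM2l // mean_chiE ?r01 //.
have hchi x : chi B x r = chi B o r by apply: chi_transitive => //; apply: r01.
exact: (pivotal_pairs_le (r01 _ rpq) hchi u v).
Qed.

End DifferentialInequalities.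

(** * The critical threshold *)

Theorem theorem1p1 (R : realType) (T : finType) (B : {set {set T}}) (o : T)
  (Omega : nat)
  (hB : is_bond_set B)
  (hconn : is_connected B)
  (htrans : is_transitive B)
  (hOmega : forall x : T, degree B x = Omega) :
  (forall (lam pc a0 : R),
     0 < lam ->
     1 < lam * cbrtV T R < #|T|%:R ->
     is_threshold B o lam pc ->
     a0 < 1 ->
     triangle_condition B pc a0 ->
     let eps0 := (chi B o pc)^-1 in
     eps0 = lam^-1 * #|T|%:R `^ (- 3^-1) /\
     1 - eps0 <= Omega%:R * pc <= (1 - eps0) / (1 - a0))
  /\
  (forall (lam1 lam2 p1 p2 : R),
     0 < lam1 -> lam1 < lam2 ->
     1 < lam1 * cbrtV T R < #|T|%:R ->
     1 < lam2 * cbrtV T R < #|T|%:R ->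
     is_threshold B o lam1 p1 ->
     is_threshold B o lam2 p2 ->
     nabla_bar B p2 < 1 ->
     (lam2 - lam1) / (lam1 * lam2) * (cbrtV T R)^-1 <= Omega%:R * (p2 - p1)
       <= (1 - nabla_bar B p2)^-1 * ((lam2 - lam1) / (lam1 * lam2))
          * (cbrtV T R)^-1).
Proof.
have V0 : 0 < cbrtV T R.
  by apply: powR_gt0; rewrite ltr0n; apply/card_gt0P; exists o.
split=> [lam pc a0 lam0 _ [/andP[pc0 pc1] chiE] a01 tri|].
  split; first by rewrite chiE invfM powRN.
  have nab x y : [set x; y] \in B -> nabla B pc x y <= a0.
    move=> /hB; rewrite cards2; have := tri x y.
    by case: eqVneq => //= _; rewrite add0r.
  have := chi_inv_increment o hB htrans hOmega (lexx 0) pc0 pc1 nab.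
  rewrite chi0 invr1 subr0 => /andP[lo up]; rewrite up /=.
  by rewrite ler_pdivlMr ?subr_gt0 // mulrC mulrA.
move=> lam1 lam2 p1 p2 lam1_gt0 lam12 _ _ [/andP[p1_0 p1_1] chi1].
move=> [/andP[p2_0 p2_1] chi2] nab1.
have p12 : p1 <= p2.
  rewrite leNgt; apply/negP => p21.
  have := chi_le_param B o p2_0 (ltW p21) p1_1.
  by rewrite chi1 chi2 ler_pM2r // leNgt lam12.
have nab x y : [set x; y] \in B -> nabla B p2 x y <= nabla_bar B p2.
  move=> xyB; exact: (le_bigmax_cond 0
    (fun xy : T * T => nabla B p2 xy.1 xy.2) (j := (x, y))).
have := chi_inv_increment o hB htrans hOmega p1_0 p12 p2_1 nab.
rewrite chi1 chi2.
have -> : (lam1 * cbrtV T R)^-1 - (lam2 * cbrtV T R)^-1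
    = (lam2 - lam1) / (lam1 * lam2) * (cbrtV T R)^-1.
  by field; rewrite !gt_eqF // (lt_trans lam1_gt0).
move=> /andP[lo up]; rewrite up /= -mulrA [leRHS]mulrC ler_pdivlMr ?subr_gt0 //.
by rewrite mulrC mulrA.
Qed.
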